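(* The Kalton--Peck space $Z_2$ is ergodic.
   Context: The scalar field $\mathbb{K}$ is $\mathbb{R}$ or $\mathbb{C}$. ''Subspace'' of a Banach space means closed vector subspace. The Kalton--Peck space $Z_2$: let $\Omega\colon\ell_2\to\mathbb{K}^{\mathbb{N}}$ be the unique homogeneous map (i.e. $\Omega(\lambda x)=\lambda\Omega(x)$ for scalars $\lambda$) such that for every $x\in\ell_2$ with $\|x\|_{\ell_2}=1$ and every $k\in\mathbb{N}$, $\Omega(x)(k)=-x(k)\log|x(k)|$ if $x(k)\neq0$ and $\Omega(x)(k)=0$ if $x(k)=0$. Then $Z_2=\{(f,g)\in\mathbb{K}^{\mathbb{N}}\times\ell_2 : f-\Omega(g)\in\ell_2\}$; it is a vector space, and $\|(f,g)\|_{\Omega}=\|f-\Omega(g)\|_{\ell_2}+\|g\|_{\ell_2}$ is a quasinorm on it which is known to be equivalent to a complete norm. $Z_2$ is regarded as a Banach space with such a norm (defined up to equivalence). $\mathbb{E}_0$ is the equivalence relation on $2^{\mathbb{N}}$ defined by $a\mathrel{\mathbb{E}_0}b$ iff $a(n)=b(n)$ for all but finitely many $n$. A separable Banach space $X$ is ergodic if $\mathbb{E}_0$ Borel reduces to the isomorphism relation between subspaces of $X$, i.e. there is a Borel map $f$ from $2^{\mathbb{N}}$ to the set of closed vector subspaces of $X$ (equipped with the Effros Borel structure) such that for all $a,b\in 2^{\mathbb{N}}$: $a\mathrel{\mathbb{E}_0}b$ if and only if $f(a)$ and $f(b)$ are isomorphic (linearly homeomorphic). *)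

(* Defs.v *)
From HB Require Import structures.
From mathcomp Require Import all_boot all_order all_algebra.
From mathcomp Require Import complex.
From mathcomp Require Import all_classical all_reals all_analysis.
From mathcomp Require Import ring.

Set Implicit Arguments.
Unset Strict Implicit.
Unset Printing Implicit Defensive.

Import Order.TTheory GRing.Theory Num.Theory.
Import numFieldNormedType.Exports.

Local Open Scope classical_set_scope.
Local Open Scope ring_scope.

(* The scalar field K stands for R or R[i].  In MathComp the norm of a K-normed
   space takes its values in K, so the real modulus [abs : K -> R] and the
   inclusion [emb : R -> K] are carried explicitly; they are related by
   [emb (abs x) = `|x|]. *)

Section KaltonPeck.
Variables (R : realType) (K : numFieldType).
Variables (abs : K -> R) (emb : {rmorphism R -> K}).
Implicit Types x f g : nat -> K.

Definition ell2 : set (nat -> K) :=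
  [set x | cvgn (series (fun k => abs (x k) ^+ 2))].

(* Meaningful only on [ell2]. *)
Definition norm2 x : R := Num.sqrt (limn (series (fun k => abs (x k) ^+ 2))).

Definition Omega_sphere x : nat -> K :=
  fun k => if x k == 0 then 0 else - x k * emb (ln (abs (x k))).

(* The homogeneous extension of [Omega_sphere] from the unit sphere to [ell2]
   (see [OmegaZ] and [Omega_unit]); it sends 0 to 0. *)
Definition Omega x : nat -> K :=
  fun k => emb (norm2 x) * Omega_sphere (fun j => (emb (norm2 x))^-1 * x j) k.

Definition Z2 : set ((nat -> K^o) * (nat -> K^o)) :=
  [set z | ell2 z.2 /\ ell2 (fun k => z.1 k - Omega z.2 k)].

Definition Z2_qnorm (z : (nat -> K^o) * (nat -> K^o)) : R :=
  norm2 (fun k => z.1 k - Omega z.2 k) + norm2 z.2.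

(* [T] identifies the Banach space [X] with the vector space [Z2] carrying a
   complete norm equivalent to the quasinorm [Z2_qnorm].  Such a norm is only
   determined up to equivalence, hence the constants [c] and [C]. *)
Definition is_Banach_Z2 (X : completeNormedModType K)
    (T : {linear X -> ((nat -> K^o) * (nat -> K^o))%type}) : Prop :=
  [/\ injective T, range T = Z2 &
      exists c C : R, [/\ 0 < c, 0 < C &
        forall x : X,
          c * abs `|x| <= Z2_qnorm (T x) /\ Z2_qnorm (T x) <= C * abs `|x|]].

Hypothesis embabs : forall a : K, emb (abs a) = `|a|.

Lemma absM (a b : K) : abs (a * b) = abs a * abs b.
Proof. by apply: (fmorph_inj emb); rewrite rmorphM !embabs normrM. Qed.

Lemma abs_eq0 (a : K) : (abs a == 0) = (a == 0).
Proof. by rewrite -(fmorph_eq0 emb) embabs normr_eq0. Qed.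

Lemma Omega_unit x : norm2 x = 1 -> Omega x = Omega_sphere x.
Proof.
move=> x1; apply/funext => k; rewrite /Omega x1 rmorph1 invr1 mul1r.
by congr (Omega_sphere _ k); apply/funext => j; rewrite mul1r.
Qed.

Hypothesis absemb : forall r : R, abs (emb r) = `|r|.
Hypothesis abs_ge0 : forall a : K, 0 <= abs a.

Lemma norm2Z (a : K) x : ell2 x -> norm2 (fun k => a * x k) = abs a * norm2 x.
Proof.
move=> xl2; rewrite /norm2.
have -> : series (fun k => abs (a * x k) ^+ 2) =
          (fun n => abs a ^+ 2 * series (fun k => abs (x k) ^+ 2) n).
  apply/funext => n; rewrite /series /= mulr_sumr.
  by apply: eq_bigr => k _; rewrite absM exprMn.
rewrite (limM (@is_cvg_cst _ _ _ _ _) xl2) lim_cst//.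
by rewrite sqrtrM ?sqr_ge0// sqrtr_sqr ger0_norm.
Qed.

Lemma OmegaZ (a : K) x k :
  ell2 x -> Omega (fun j => a * x j) k = a * Omega x k.
Proof.
move=> xl2; rewrite /Omega norm2Z// /Omega_sphere.
have [->|a0] := eqVneq a 0; first by rewrite !mul0r mulr0 eqxx mulr0.
have [->|n0] := eqVneq (norm2 x) 0; first by rewrite !mulr0 rmorph0 !mul0r mulr0.
have aa0 : abs a != 0 by rewrite abs_eq0.
have aE : emb (abs a) != 0 by rewrite fmorph_eq0.
have nE : emb (norm2 x) != 0 by rewrite fmorph_eq0.
have -> : abs ((emb (abs a * norm2 x))^-1 * (a * x k)) =
          abs ((emb (norm2 x))^-1 * x k).
  rewrite !absM -!fmorphV !absemb !normfV normrM (ger0_norm (abs_ge0 a)).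
  by rewrite invfM mulrACA mulVf// mul1r.
rewrite !mulf_eq0 !invr_eq0 !rmorphM !mulf_eq0 (negbTE a0) (negbTE aE) (negbTE nE)/=.
case: ifP => _; first by rewrite !mulr0.
by rewrite invfM; field; rewrite aE nE.
Qed.

End KaltonPeck.

Section Ergodic.
Variables (K : numFieldType) (X : completeNormedModType K).
Implicit Types F G U : set X.

Definition closed_subspace F : Prop :=
  [/\ closed F, F 0 & forall (a : K) (x y : X), F x -> F y -> F (a *: x + y)].

(* The sigma-algebra, on the set of closed subspaces of [X], generated by the
   sets of subspaces that meet a given open set. *)
Definition Effros : set (set (set X)) :=
  <<s closed_subspace,
      [set [set F | closed_subspace F /\ F `&` U !=set0] | U in open] >>.

Definition isomorphic F G : Prop :=
  exists u v : X -> X,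
    [/\ forall (a : K) (x y : X), F x -> F y -> u (a *: x + y) = a *: u x + u y,
        (forall x, F x -> G (u x) /\ v (u x) = x),
        (forall y, G y -> F (v y) /\ u (v y) = y),
        {within F, continuous u} &
        {within G, continuous v}].

Definition E0 (a b : cantor_space) : Prop := \forall n \near \oo, a n = b n.

(* The notion is meant for separable [X], as Banach models of [Z2] are. *)
Definition ergodic : Prop :=
  exists f : cantor_space -> set X,
    [/\ forall a, closed_subspace (f a),
        forall B, Effros B -> <<s (open : set (set cantor_space)) >> (f @^-1` B) &
        forall a b, E0 a b <-> isomorphic (f a) (f b)].

End Ergodic.

(* Main.v *)
Require Import Defs.
From mathcomp Require Import all_boot all_order all_algebra.
From mathcomp Require Import complex.
From mathcomp Require Import all_classical all_reals all_analysis.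
From mathcomp Require Import ring lra zify.

Import Order.TTheory GRing.Theory Num.Theory.
Import numFieldNormedType.Exports.
Local Open Scope classical_set_scope.
Local Open Scope ring_scope.

(* Cut the coordinates into consecutive blocks of rapidly increasing length,
   the [n]-th one starting at [d_n].  For [s] in the Cantor space let [F(s)] be
   the closed span of the finitely supported [(f, g)] with [f = - t_n g] on the
   [n]-th block if [s n], and [g = 0] there otherwise, where [t_n = d_n + 1].
   Changing finitely many values of [s] is a finite-rank perturbation.

   On the line [f = - t g] the quasinorm is
     ||(t + ln (||g|| / |g|)) g||_2 + ||g||_2.
   Hence [M] disjoint vectors with [||g||_2 = 1] have signed sums of quasinorm
   at least [sqrt M * (ln M) / 2], for all signs, whereas [M] vectors living on
   lines with [t >= 1 + ln M] and on lines [g = 0] behave as in a Hilbert space: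
   some signed sum has quasinorm at most [6 sqrt M] times the largest one.  If
   [s n] and not [t n], an isomorphism [F(s) -> F(t)] is applied to [M] disjoint
   vectors of the [n]-th block, each with [d_n + 1] coordinates chosen so that
   the image vanishes on all earlier blocks; only blocks with much larger
   parameters remain, and the comparison bounds [n] by the isomorphism constant. *)

(** * Consecutive blocks of coordinates *)

(* [block_radius d] bounds the quasinorm of a vector on the line
   [f = - (d + 1) g] with [d + 1] coordinates and [norm2 g = 1]. *)
Definition block_radius (d : nat) : nat := (d.+2 * d.+1).+1.

(** The exponent makes the logarithm of the count at least [n * block_radius d], since [ln 4 >= 1].
    Dividing by [block_radius d] later leaves a bound on [n] alone. *)
Definition group_count (n d : nat) : nat := 4 ^ (n * block_radius d).

(** With [d = block_start m], block [m] consists of [group_count m d] groups of [d + 1] coordinates: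
    one more than the number of earlier coordinates, so that a dimension count applies in each
    group. *)
Fixpoint block_start (n : nat) : nat :=
  if n is m.+1 then
    block_start m + group_count m (block_start m) * (block_start m).+1
  else 0.

Lemma group_count_gt0 n d : (0 < group_count n d)%N.
Proof. by rewrite expn_gt0. Qed.

(** Every block after the [n]-th thus has a parameter exceeding the number of groups in the [n]-th,
    as freezing the logarithms requires. *)
Lemma block_startS n :
  (group_count n (block_start n) + block_start n <= block_start n.+1)%N.
Proof. by rewrite /= addnC leq_add2l leq_pmulr. Qed.

Lemma block_start_mono m n : (m <= n)%N -> (block_start m <= block_start n)%N.
Proof.
move: m n; apply: (homo_leq leqnn leq_trans) => n; exact: leq_addr.
Qed.

Lemma leq_block_start n : (n <= block_start n)%N.
Proof.
elim: n => // n IH; apply: leq_trans (block_startS n).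
by have := group_count_gt0 n (block_start n); lia.
Qed.

Fact block_exists k : exists n, (k < block_start n.+1)%N.
Proof. by exists k; exact: leq_block_start. Qed.

Definition block k : nat := ex_minn (block_exists k).

(** An order adjunction between [block] and [block_start], which trades block indices for
    coordinates. *)
Lemma ltn_block k n : (block k < n)%N = (k < block_start n)%N.
Proof.
rewrite /block; case: ex_minnP => m km mmin; apply/idP/idP => [mn|].
  exact: leq_trans km (block_start_mono _ _ mn).
by case: n => // n /mmin.
Qed.

Lemma block_eq n k : (block_start n <= k < block_start n.+1)%N -> block k = n.
Proof.
move=> /andP[nk kn]; apply/eqP; rewrite eqn_leq -ltnS ltn_block kn /=.
by rewrite leqNgt ltn_block -leqNgt.
Qed.

Lemma group_inj (q i j a : nat) :
  (i * q <= a < i * q + q)%N -> (j * q <= a < j * q + q)%N -> i = j.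
Proof.
wlog ij : i j / (i <= j)%N.
  move=> h hi hj; have [ij|/ltnW ji] := leqP i j; first exact: h.
  by apply/esym; exact: h.
move=> /andP[_ h1] /andP[h2 _]; apply/eqP; rewrite eqn_leq ij /= leqNgt.
apply/negP => /(leq_mul (leqnn q)); nia.
Qed.

(** * Real inequalities for logarithms and sums of squares *)

Section RealInequalities.
Context {R : realType}.
Implicit Types x y s : R.

Lemma ln_leB1 {x} : 0 < x -> ln x <= x - 1.
Proof.
move=> x0; have := @le_ln1Dx R (x - 1); rewrite subrKC; apply.
by rewrite ltrBrDr addrC subrr.
Qed.

Lemma le_of_sqr {x y} : 0 <= y -> x ^+ 2 <= y ^+ 2 -> x <= y.
Proof. by move=> y0 xy; rewrite leNgt; apply/negP => yx; nra. Qed.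

Lemma sqr_le {x y} : 0 <= x -> x <= y -> x ^+ 2 <= y ^+ 2.
Proof. by move=> x0 xy; nra. Qed.

(** By [ln y <= y - 1] at [y = s / x], the product is at most [s - x]. When [s <= 0] the logarithm
    takes its default value 0. *)
Lemma xln_ratio_le1 {x s} : 0 <= x -> x <= 1 -> s <= 1 -> x * ln (s / x) <= 1.
Proof.
rewrite le_eqVlt => /predU1P[<- _ _|x0 x1 s1]; first by rewrite mul0r.
have [s0|s0] := lerP s 0.
  by rewrite ln0 ?mulr0// pmulr_lle0// invr_gt0.
have := @ln_leB1 (s / x) (divr_gt0 s0 x0).
rewrite -(ler_pM2l x0) (_ : x * (s / x - 1) = s - x); first lra.
by field; rewrite gt_eqF.
Qed.

(** The function [x ln (B / x)] increases up to [B / e]. Indeed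
    [ln (B / x) = ln (B / s) + ln (s / x)], and [x ln (s / x) <= s - x <= (s - x) ln (B / s)]. *)
Lemma xln_ratio_mono {x s B} :
  0 < x -> x <= s -> 1 <= ln (B / s) -> x * ln (B / x) <= s * ln (B / s).
Proof.
move=> x0 xs Bs; have s0 : 0 < s by apply: lt_le_trans xs.
have B0 : 0 < B.
  rewrite ltNge; apply/negP => B0; move: Bs.
  by rewrite ln0 ?ler10// pmulr_lle0// invr_gt0.
have -> : B / x = (B / s) * (s / x) by field; rewrite !gt_eqF.
rewrite lnM ?posrE ?divr_gt0//.
have := @ln_leB1 (s / x) (divr_gt0 s0 x0).
rewrite -(ler_pM2l x0) (_ : x * (s / x - 1) = s - x); last by field; rewrite gt_eqF.
move=> h.
have h2 : 0 <= (s - x) * (ln (B / s) - 1) by rewrite mulr_ge0// subr_ge0.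
nra.
Qed.

Lemma ln_ratio_ge0 {x s} : 0 <= x -> x <= s -> 0 <= ln (s / x).
Proof.
rewrite le_eqVlt => /predU1P[<- _|x0 xs]; first by rewrite invr0 mulr0 ln0.
by apply: ln_ge0; rewrite ler_pdivlMr// mul1r.
Qed.

(** The bound [ln x <= x - 1] at [1 / 2], doubled. *)
Lemma ln4_ge1 : 1 <= ln (4 : R).
Proof.
have h : ln (4 : R) = - (2 * ln (1 / 2)).
  have -> : (4 : R) = (1 / 2 * (1 / 2))^-1 by field.
  rewrite lnV ?posrE; last by lra.
  by rewrite lnM ?posrE; [ring|lra|lra].
have := @ln_leB1 (1 / 2); rewrite h; lra.
Qed.

Lemma sqr_sumr_le {I : finType} (F : I -> R) :
  (\sum_i F i) ^+ 2 <= #|I|%:R * \sum_i F i ^+ 2.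
Proof.
set s := \sum_i F i; set q := \sum_i F i ^+ 2; set n := #|I|%:R : R.
have [n0|n0] := eqVneq #|I| 0%N.
  have s0 : s = 0 by apply: big1 => i _; have := fintype0 i n0.
  by rewrite s0 expr0n /n n0 mul0r.
have np : 0 < n by rewrite ltr0n lt0n.
(* Cauchy--Schwarz against the constant vector: this sum of squares expands to [n (n q - s^2)]. *)
have : 0 <= \sum_i (n * F i - s) ^+ 2 by apply: sumr_ge0 => i _; exact: sqr_ge0.
have -> : \sum_i (n * F i - s) ^+ 2 = n ^+ 2 * q - n * s * 2 * s + s ^+ 2 * n.
  transitivity (\sum_i (n ^+ 2 * F i ^+ 2 + (- (n * s * 2) * F i + s ^+ 2))).
    by apply: eq_bigr => i _; ring.
  rewrite !big_split /= -!mulr_sumr sumr_const -(mulr_natr s) -/s -/q -/n; ring.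
have -> : n ^+ 2 * q - n * s * 2 * s + s ^+ 2 * n = n * (n * q - s ^+ 2) by ring.
by rewrite pmulr_rge0// subr_ge0.
Qed.

End RealInequalities.

(** * The modulus and square-summable sequences over [K] *)

Section Scalars.
Context {R : realType} {K : numFieldType} (abs : K -> R) (emb : {rmorphism R -> K}).
Hypothesis embabs : forall a : K, emb (abs a) = `|a|.
Hypothesis absemb : forall r : R, abs (emb r) = `|r|.
Hypothesis abs_ge0 : forall a : K, 0 <= abs a.
Hypothesis abs_parallelogram : forall a b : K,
  abs (a + b) ^+ 2 + abs (a - b) ^+ 2 = 2 * (abs a ^+ 2 + abs b ^+ 2).
Implicit Types x y : nat -> K.

Let absM := absM embabs.
Let abs_eq0 := abs_eq0 embabs.

(** A ring morphism need not respect the order; here it does because the two hypotheses on [abs] and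
    [emb] identify the image of [|r|] with [|emb r|]. *)
Lemma emb_ge0 (r : R) : (0 <= emb r) = (0 <= r).
Proof.
apply/idP/idP => r0; last by rewrite -(ger0_norm r0) -absemb embabs.
rewrite (fmorph_inj emb _ : r = `|r|) ?normr_ge0//.
by rewrite -absemb embabs ger0_norm.
Qed.

Lemma ler_emb (r s : R) : (emb r <= emb s) = (r <= s).
Proof. by rewrite -subr_ge0 -rmorphB emb_ge0 subr_ge0. Qed.

Lemma ltr_emb (r s : R) : (emb r < emb s) = (r < s).
Proof. by rewrite !lt_neqAle ler_emb (inj_eq (fmorph_inj emb)). Qed.

Lemma abs0 : abs 0 = 0.
Proof. by apply/eqP; rewrite abs_eq0. Qed.

Lemma absN a : abs (- a) = abs a.
Proof. by apply: (fmorph_inj emb); rewrite !embabs normrN. Qed.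

Lemma absD (a b : K) : abs (a + b) <= abs a + abs b.
Proof. by rewrite -ler_emb rmorphD !embabs ler_normD. Qed.

Lemma abs_sum (I : Type) (r : seq I) (F : I -> K) :
  abs (\sum_(i <- r) F i) <= \sum_(i <- r) abs (F i).
Proof.
rewrite -ler_emb rmorph_sum embabs (le_trans (ler_norm_sum _ _ _))//.
by apply: ler_sum => i _; rewrite embabs.
Qed.

Lemma abs_sign a (e : bool) : abs ((-1) ^+ e * a) = abs a.
Proof. by case: e; rewrite ?mulN1r ?absN// mul1r. Qed.

(** Combines membership in [ell2] with a bound on the squared norm, through partial sums only, so
    that estimates avoid limits. *)
Definition l2le x (B : R) := forall n, \sum_(k < n) abs (x k) ^+ 2 <= B.

Lemma series_sq x n : series (fun k => abs (x k) ^+ 2) n = \sum_(k < n) abs (x k) ^+ 2.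
Proof. by rewrite /series /= big_mkord. Qed.

Lemma sum_sq_mono x (m n : nat) : (m <= n)%N ->
  \sum_(k < m) abs (x k) ^+ 2 <= \sum_(k < n) abs (x k) ^+ 2.
Proof.
move=> mn; rewrite -!(big_mkord xpredT (fun k => abs (x k) ^+ 2)).
rewrite [leRHS](@big_cat_nat _ _ _ m)//= lerDl; apply: sumr_ge0 => i _.
exact: sqr_ge0.
Qed.

Lemma l2leW {x B C} : B <= C -> l2le x B -> l2le x C.
Proof. by move=> BC xB n; apply: le_trans BC. Qed.

Lemma norm2_ge0 x : 0 <= norm2 abs x.
Proof. exact: sqrtr_ge0. Qed.

Lemma ell2_norm2_sqr {x} : ell2 abs x ->
  norm2 abs x ^+ 2 = limn (series (fun k => abs (x k) ^+ 2)).
Proof.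
move=> xl; rewrite /norm2 sqr_sqrtr//.
have := nondecreasing_cvgn_le _ xl; move/(_ _ 0%N); rewrite series_sq big_ord0; apply.
by move=> m n mn; rewrite !series_sq sum_sq_mono.
Qed.

Lemma l2le_norm2 {x} : ell2 abs x -> l2le x (norm2 abs x ^+ 2).
Proof.
move=> xl n; rewrite ell2_norm2_sqr// -series_sq.
by apply: nondecreasing_cvgn_le => // i j ij; rewrite !series_sq sum_sq_mono.
Qed.

Lemma l2le_ell2 {x B} : l2le x B -> ell2 abs x.
Proof.
move=> xB; apply: nondecreasing_is_cvgn.
  by move=> i j ij; rewrite !series_sq sum_sq_mono.
by exists B => _ [n _ <-]; rewrite series_sq.
Qed.

Lemma norm2_sqr_le {x B} : l2le x B -> norm2 abs x ^+ 2 <= B.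
Proof.
move=> xB; have xl := l2le_ell2 xB; rewrite ell2_norm2_sqr//.
by apply: limr_le => //; apply: nearW => n; rewrite series_sq.
Qed.

Lemma norm2_le {x} {B : R} : 0 <= B -> l2le x (B ^+ 2) -> norm2 abs x <= B.
Proof. by move=> B0 /norm2_sqr_le; rewrite ler_pXn2r// nnegrE norm2_ge0. Qed.

Lemma abs_le_norm2 {x} k : ell2 abs x -> abs (x k) <= norm2 abs x.
Proof.
move=> /l2le_norm2/(_ k.+1); rewrite big_ord_recr /= => h.
rewrite -(@ler_pXn2r _ 2)// ?nnegrE ?norm2_ge0//; apply: le_trans h.
by rewrite lerDr sumr_ge0// => i _; exact: sqr_ge0.
Qed.

Lemma l2le_fin {x} N : (forall k, (N <= k)%N -> x k = 0) ->
  l2le x (\sum_(k < N) abs (x k) ^+ 2).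
Proof.
move=> xN n; have [nN|Nn] := leqP n N; first exact: sum_sq_mono.
rewrite -!(big_mkord xpredT (fun k => abs (x k) ^+ 2)).
rewrite [leLHS](@big_cat_nat _ _ _ N)//= ?(ltnW Nn)// gerDl big_nat_cond big1//.
by move=> k /andP[/andP[Nk _] _]; rewrite xN// abs0 expr0n.
Qed.

Lemma norm2_fin {x} N : (forall k, (N <= k)%N -> x k = 0) ->
  norm2 abs x ^+ 2 = \sum_(k < N) abs (x k) ^+ 2.
Proof.
move=> xN; apply/eqP; rewrite eq_le norm2_sqr_le//=; last exact: l2le_fin.
exact: (l2le_norm2 (l2le_ell2 (l2le_fin _ xN)) N).
Qed.

Lemma l2le_dom {x y} {c B} : 0 <= c -> (forall k, abs (x k) <= c * abs (y k)) ->
  l2le y B -> l2le x (c ^+ 2 * B).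
Proof.
move=> c0 xy yB n; apply: (@le_trans _ _ (c ^+ 2 * \sum_(k < n) abs (y k) ^+ 2)).
  rewrite mulr_sumr; apply: ler_sum => k _; rewrite -exprMn.
  by rewrite ler_pXn2r ?nnegrE ?mulr_ge0.
by rewrite ler_wpM2l// sqr_ge0.
Qed.

Lemma l2le_sqdom {x} (y z : nat -> K) {c d B C} : 0 <= c -> 0 <= d ->
  (forall k, abs (x k) ^+ 2 <= c * abs (y k) ^+ 2 + d * abs (z k) ^+ 2) ->
  l2le y B -> l2le z C -> l2le x (c * B + d * C).
Proof.
move=> c0 d0 xyz yB zC n.
apply: le_trans (lerD (ler_wpM2l c0 (yB n)) (ler_wpM2l d0 (zC n))).
by rewrite !mulr_sumr -big_split; apply: ler_sum => k _.
Qed.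

Lemma norm2_eq0 {x} : ell2 abs x -> norm2 abs x = 0 -> forall k, x k = 0.
Proof.
move=> xl x0 k; apply/eqP; rewrite -abs_eq0 eq_le abs_ge0 andbT -x0.
exact: abs_le_norm2.
Qed.

(** The normalization in [Omega] and the sign in [Omega_sphere] merge into the logarithm of one
    ratio, at least 1 where [x k] is nonzero. Degenerate cases agree because the factor [x k]
    vanishes. *)
Lemma OmegaE {x} k : ell2 abs x ->
  Omega abs emb x k = x k * emb (ln (norm2 abs x / abs (x k))).
Proof.
move=> xl; rewrite /Omega /Omega_sphere.
have [n0|n0] := eqVneq (norm2 abs x) 0.
  by rewrite n0 rmorph0 mul0r (norm2_eq0 xl n0) mul0r.
have np : 0 < norm2 abs x by rewrite lt_neqAle eq_sym n0 norm2_ge0.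
have en : emb (norm2 abs x) != 0 by rewrite fmorph_eq0.
rewrite mulf_eq0 invr_eq0 (negbTE en)/=.
have [->|xk] := eqVneq (x k) 0; first by rewrite mulr0 mul0r.
have xp : 0 < abs (x k) by rewrite lt_neqAle abs_ge0 eq_sym abs_eq0 xk.
have -> : abs ((emb (norm2 abs x))^-1 * x k) = (norm2 abs x / abs (x k))^-1.
  by rewrite absM -fmorphV absemb normfV ger0_norm ?norm2_ge0// invf_div mulrC.
by rewrite lnV ?posrE ?divr_gt0// rmorphN mulrNN !mulrA mulfV// mul1r.
Qed.

(** * Signed sums of small quasinorm *)

(* Greedy choice of signs: by the parallelogram law one of [x + y], [x - y]
   has square norm at most the sum of the two square norms. *)
Lemma l2le_addsub {x y} {B C} : l2le x B -> l2le y C ->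
  exists e : bool, l2le (fun k => x k + (-1) ^+ e * y k) (B + C).
Proof.
move=> xB yC; apply: contrapT => /forallNP h.
have /existsNP[m hm] := h false; have /existsNP[n hn] := h true.
(* Partial sums increase, so both bounds already fail at the common truncation [N], against the
   parallelogram law summed below [N]. *)
set N := maxn m n.
have hp : B + C < \sum_(k < N) abs (x k + y k) ^+ 2.
  move/negP: hm; rewrite -ltNge => /lt_le_trans; apply.
  under eq_bigr do rewrite mul1r.
  by apply: (@sum_sq_mono (fun k => x k + y k)); rewrite leq_maxl.
have hm' : B + C < \sum_(k < N) abs (x k - y k) ^+ 2.
  move/negP: hn; rewrite -ltNge => /lt_le_trans; apply.
  under eq_bigr do rewrite mulN1r.
  by apply: (@sum_sq_mono (fun k => x k - y k)); rewrite leq_maxr.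
have := ltrD hp hm'; rewrite -big_split /=.
under eq_bigr do rewrite abs_parallelogram.
rewrite -mulr_sumr big_split /=.
have := xB N; have := yC N; lra.
Qed.

Lemma exists_signs (p : nat -> nat -> K) (B : R) M :
  (forall i, (i < M)%N -> l2le (p i) B) ->
  exists e : nat -> bool,
    l2le (fun k => \sum_(i < M) (-1) ^+ e i * p i k) (M%:R * B).
Proof.
elim: M => [|M IH] pB.
  exists xpredT => n; rewrite mul0r big1// => k _.
  by rewrite big_ord0 abs0 expr0n.
have [i iM|e he] := IH; first by apply: pB; rewrite ltnW.
have [e' he'] := l2le_addsub he (pB M (ltnSn M)).
exists (fun i => if i == M then e' else e i).
rewrite -[M.+1%:R]natr1 mulrDl mul1r; move: he'.
congr (l2le _ _); apply/funext => k; rewrite big_ord_recr /= eqxx; congr (_ + _).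
by apply: eq_bigr => i _; rewrite ltn_eqF.
Qed.

(** The minus sign in the equation of the line prevents cancellation: [f - Omega x] equals
    [- (t + ln (||x|| / |x k|)) x k], a sum of two nonnegative coefficients. *)
Lemma abs_sub_Omega f {x} (t : R) k : ell2 abs x -> 0 <= t -> f = - emb t * x k ->
  abs (f - Omega abs emb x k) = (t + ln (norm2 abs x / abs (x k))) * abs (x k).
Proof.
move=> xl t0 ->; rewrite OmegaE// mulrC -mulrBr -opprD -rmorphD absM absN absemb.
by rewrite mulrC ger0_norm// addr_ge0// ln_ratio_ge0// abs_le_norm2.
Qed.

Lemma Omega0 {x} k : ell2 abs x -> x k = 0 -> Omega abs emb x k = 0.
Proof. by move=> xl xk; rewrite OmegaE// xk mul0r. Qed.

Lemma abs_gt0 a : (0 < abs a) = (a != 0).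
Proof. by rewrite lt_neqAle abs_ge0 andbT eq_sym abs_eq0. Qed.

(* With at most [M] vectors whose parameters are at least [1 + ln M], the
   logarithms in [Omega] can be frozen at the square function [sigma] of the
   family; the quasinorm is then dominated by a Hilbertian norm, for which the
   parallelogram law provides good signs. *)
Lemma exists_signs_Z2 (A : pred nat) (tau : nat -> R) (f h : nat -> nat -> K)
    (M : nat) (rho T0 : R) :
  (0 < M)%N -> 0 < rho -> 1 + ln M%:R <= T0 ->
  (forall k, A k -> T0 <= tau k) ->
  (forall i k, (i < M)%N -> A k -> f i k = - emb (tau k) * h i k) ->
  (forall i k, (i < M)%N -> ~~ A k -> h i k = 0) ->
  (forall i, (i < M)%N -> Z2 abs emb (f i, h i)) ->
  (forall i, (i < M)%N -> Z2_qnorm abs emb (f i, h i) <= rho) ->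
  exists e : nat -> bool,
    Z2_qnorm abs emb (fun k => \sum_(i < M) (-1) ^+ e i * f i k,
                      fun k => \sum_(i < M) (-1) ^+ e i * h i k)
      <= 6 * (Num.sqrt M%:R * rho).
Proof.
move=> M0 rho0 MT0 Atau fh h0 fhZ2 fhQ.
have M1 : 1 <= M%:R :> R by rewrite ler1n.
have lnM0 : 0 <= ln M%:R :> R by rewrite ln_ge0.
have T1 : 1 <= T0 by lra.
have T00 : 0 < T0 by lra.
pose F i k := f i k - Omega abs emb (h i) k.
pose G i := norm2 abs (h i).
(* [eta] will bound every norm [G i], since [|F i k| >= T0 |h i k|] on [A] and [h i] vanishes
   elsewhere. *)
pose eta := rho / T0.
have eta0 : 0 < eta by rewrite divr_gt0.
(* The factor [e] keeps every [s <= M eta] in the range where [s ln (B / s)] increases, and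
   [ln (B / eta) = 1 + ln M <= T0] gives [eta ln (B / eta) <= rho]. *)
pose B := expR 1 * (M%:R * eta).
have B0 : 0 < B by rewrite mulr_gt0 ?expR_gt0// mulr_gt0// ltr0n.
have G0 i : 0 <= G i by exact: norm2_ge0.
have lB (s : R) : 0 < s -> s <= M%:R * eta -> 1 <= ln (B / s).
  move=> s0 sM; rewrite -[leLHS]expRK ler_ln ?posrE ?expR_gt0 ?divr_gt0//.
  by rewrite ler_pdivlMr// ler_pM2l ?expR_gt0.
have lBeta : ln (B / eta) = 1 + ln M%:R.
  have -> : B / eta = expR 1 * M%:R by rewrite /B; field; rewrite gt_eqF.
  by rewrite lnM ?posrE ?expR_gt0 ?ltr0n// expRK.
have etaM : eta <= M%:R * eta by rewrite ler_peMl// ltW.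
have hell i : (i < M)%N -> ell2 abs (h i) by case/fhZ2.
have FG i : (i < M)%N -> norm2 abs (F i) + G i <= rho by exact: fhQ.
have Fell i : (i < M)%N -> l2le (F i) (rho ^+ 2).
  move=> iM; have [_ /= /l2le_norm2] := fhZ2 _ iM; apply: l2leW.
  apply: sqr_le; first exact: norm2_ge0.
  by have := FG _ iM; have := G0 i; rewrite /F; lra.
have absF i k : (i < M)%N -> A k ->
    abs (F i k) = (tau k + ln (G i / abs (h i k))) * abs (h i k).
  move=> iM Ak; apply: abs_sub_Omega; [exact: hell| |exact: fh].
  by apply: le_trans (Atau _ Ak); rewrite ltW.
have Geta i : (i < M)%N -> G i <= eta.
  move=> iM; apply: norm2_le; first exact: ltW.
  rewrite /eta mulrC exprMn; apply: l2le_dom (Fell _ iM).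
    by rewrite invr_ge0 ltW.
  move=> k; have [Ak|nAk] := boolP (A k); last first.
    by rewrite h0// abs0 mulr_ge0// invr_ge0 ltW.
  rewrite mulrC ler_pdivlMr// absF// mulrC ler_wpM2r//.
  apply: (le_trans (Atau _ Ak)); rewrite lerDl ln_ratio_ge0//.
  exact: abs_le_norm2 (hell _ iM).
pose sg2 k := \sum_(i < M) abs (h i k) ^+ 2.
pose sg k : R := Num.sqrt (sg2 k).
have sg20 k : 0 <= sg2 k by apply: sumr_ge0 => i _; exact: sqr_ge0.
have sgE k : sg k ^+ 2 = sg2 k by rewrite sqr_sqrtr.
have sg0 k : 0 <= sg k by exact: sqrtr_ge0.
have hG i k : (i < M)%N -> abs (h i k) <= G i.
  by move=> iM; apply: abs_le_norm2; exact: hell.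
have sgM k : sg k <= M%:R * eta.
  apply: le_of_sqr; [by rewrite mulr_ge0// ltW|rewrite sgE].
  apply: (@le_trans _ _ (\sum_(i < M) eta ^+ 2)).
    apply: ler_sum => i _; apply: sqr_le => //.
    by rewrite (le_trans (hG _ _ (ltn_ord i)))// Geta.
  rewrite sumr_const card_ord -[eta ^+ 2 *+ M]mulr_natl [leRHS]exprMn.
  rewrite ler_wpM2r ?sqr_ge0//.
  by rewrite expr2 ler_peMl.
have hsg i k : (i < M)%N -> abs (h i k) <= sg k.
  move=> iM; apply: le_of_sqr; rewrite ?sgE//.
  rewrite /sg2 (bigD1 (Ordinal iM))//= lerDl; apply: sumr_ge0 => j _.
  exact: sqr_ge0.
pose L k := ln (B / sg k).
have L0 k : 0 <= L k.
  have [s0|s0] := ltP 0 (sg k); first by have := lB _ s0 (sgM k); rewrite /L; lra.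
  by rewrite /L (_ : sg k = 0) ?invr0 ?mulr0 ?ln0//; apply/eqP; rewrite eq_le s0 sg0.
pose p i k := if A k then emb (tau k + L k) * h i k else f i k.
have tauL k : A k -> 0 <= tau k + L k.
  by move=> Ak; have := Atau _ Ak; have := L0 k; lra.
have absp i k : A k -> abs (p i k) = (tau k + L k) * abs (h i k).
  by move=> Ak; rewrite /p Ak absM absemb ger0_norm// tauL.
(* Since [|h i k| <= sg k], freezing costs at most [l]: [L k <= ln (G i / |h i k|) + l]. As
   [G i * l <= rho], the error has norm at most [rho], and squaring a sum of two terms gives the
   4. *)
have pl2 i : (i < M)%N -> l2le (p i) (4 * rho ^+ 2).
  move=> iM; set l := ln (B / G i).
  have Gl : G i * l <= rho /\ 0 <= l.
    have [g0|g0] := ltP 0 (G i).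
      split; last by have := lB _ g0 (le_trans (Geta _ iM) etaM); rewrite /l; lra.
      apply: le_trans (xln_ratio_mono g0 (Geta _ iM) _) _.
        by rewrite lBeta; lra.
      by rewrite lBeta /eta -mulrA ler_piMr ?(ltW rho0)// mulrC ler_pdivrMr ?mul1r.
    have Gi0 : G i = 0 by apply/eqP; rewrite eq_le g0 G0.
    by rewrite /l Gi0 mul0r invr0 mulr0 ln0// ltW.
  case: Gl => Gl l0.
  apply: (@l2leW _ (2 * rho ^+ 2 + (2 * l ^+ 2) * G i ^+ 2)).
    have : (G i * l) ^+ 2 <= rho ^+ 2.
      by apply: sqr_le => //; rewrite mulr_ge0.
    rewrite exprMn; lra.
  apply: (l2le_sqdom (F i) (h i)) => //.
  - by have := sqr_ge0 l; lra.
  - move=> k; have [Ak|nAk] := boolP (A k); last first.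
      rewrite {1}/p (negbTE nAk) (_ : F i k = f i k).
        by have := sqr_ge0 (abs (f i k)); rewrite h0// abs0; nra.
      by rewrite /F Omega0 ?subr0//; [exact: hell|exact: h0].
    have [hik|hik] := eqVneq (h i k) 0.
      rewrite absp// hik abs0 mulr0 expr0n /=.
      by have := sqr_ge0 (abs (F i k)); lra.
    rewrite absp// absF//; have hp : 0 < abs (h i k) by rewrite abs_gt0.
    have Gp : 0 < G i by exact: (lt_le_trans hp (hG _ _ iM)).
    have sp : 0 < sg k by exact: (lt_le_trans hp (hsg _ _ iM)).
    have Lk : L k <= ln (G i / abs (h i k)) + l.
      rewrite /l -lnM ?posrE ?divr_gt0// ler_ln ?posrE ?divr_gt0//; last first.
        by rewrite mulr_gt0 ?divr_gt0.
      have -> : G i / abs (h i k) * (B / G i) = B / abs (h i k).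
        by field; rewrite !gt_eqF.
      by rewrite ler_pM2l// lef_pV2 ?posrE// hsg.
    set u := ln (G i / _) in Lk *; set x := abs (h i k) in hp *.
    have : (tau k + L k) * x <= (tau k + u) * x + l * x.
      by rewrite -mulrDl ler_pM2r//; lra.
    have h1 : 0 <= (tau k + L k) * x by rewrite mulr_ge0 ?tauL// ltW.
    move=> /(sqr_le h1) h2; have := sqr_ge0 ((tau k + u) * x - l * x).
    nra.
  - exact: Fell.
  - exact: l2le_norm2 (hell _ iM).
have [e Pl2] := exists_signs p _ _ pl2; exists e.
set W := (X in Z2_qnorm _ _ (X, _)); set S := (X in Z2_qnorm _ _ (_, X)).
set P := (X in l2le X _) in Pl2.
have PA k : A k -> P k = emb (tau k + L k) * S k.
  by move=> Ak; rewrite mulr_sumr; apply: eq_bigr => i _; rewrite /p Ak mulrCA.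
have PnA k : ~~ A k -> P k = W k.
  by move=> Ak; apply: eq_bigr => i _; rewrite /p (negbTE Ak).
have WS k : A k -> W k = - emb (tau k) * S k.
  by move=> Ak; rewrite mulr_sumr; apply: eq_bigr => i _; rewrite fh// mulrCA.
have SnA k : ~~ A k -> S k = 0.
  by move=> Ak; apply: big1 => i _; rewrite h0// mulr0.
have absP k : A k -> abs (P k) = (tau k + L k) * abs (S k).
  by move=> Ak; rewrite PA// absM absemb ger0_norm// tauL.
have SP k : abs (S k) <= 1 * abs (P k).
  rewrite mul1r; have [Ak|nAk] := boolP (A k); last by rewrite SnA// abs0.
  by rewrite absP// ler_peMl//; have := Atau _ Ak; have := L0 k; lra.
have Sl2 : l2le S (M%:R * (4 * rho ^+ 2)).
  by have := l2le_dom ler01 SP Pl2; rewrite expr1n mul1r.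
have SM k : abs (S k) ^+ 2 <= M%:R * sg2 k.
  have -> : M%:R = #|'I_M|%:R :> R by rewrite card_ord.
  apply: le_trans (sqr_sumr_le _); apply: sqr_le => //.
  by apply: le_trans (abs_sum _ _ _) _; apply: ler_sum => i _; rewrite abs_sign.
(* By Cauchy--Schwarz this holds for every choice of signs; it allows [B] to replace the norm of [S]
   inside the logarithm. *)
have SB : norm2 abs S <= M%:R * eta.
  apply: norm2_le; first by rewrite mulr_ge0// ltW.
  move=> n; apply: (@le_trans _ _ (M%:R * \sum_(k < n) sg2 k)).
    by rewrite mulr_sumr; apply: ler_sum => k _.
  rewrite [leRHS]exprMn expr2 -mulrA ler_wpM2l// exchange_big /=.
  rewrite mulr_natl -[in leRHS](card_ord M) -sumr_const; apply: ler_sum => i _.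
  apply: le_trans (l2le_norm2 (hell _ (ltn_ord i)) n) _.
  by apply: sqr_le; rewrite ?norm2_ge0// Geta.
have Sell := l2le_ell2 Sl2.
pose FS k := W k - Omega abs emb S k.
have FSk k : abs (FS k) ^+ 2 <= 2 * abs (P k) ^+ 2 + 2 * \sum_(i < M) abs (p i k) ^+ 2.
  have sp0 : 0 <= \sum_(i < M) abs (p i k) ^+ 2.
    by apply: sumr_ge0 => i _; exact: sqr_ge0.
  have [Ak|nAk] := boolP (A k); last first.
    rewrite /FS Omega0// ?SnA// subr0 -PnA//; have := sqr_ge0 (abs (P k)); lra.
  have FSE : abs (FS k) = (tau k + ln (norm2 abs S / abs (S k))) * abs (S k).
    by apply: abs_sub_Omega => //; [have := Atau _ Ak; lra|exact: WS].
  have [Sk|Sk] := eqVneq (S k) 0.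
    by rewrite FSE Sk abs0 mulr0 expr0n /= addr_ge0// mulr_ge0// sqr_ge0.
  have Sp : 0 < abs (S k) by rewrite abs_gt0.
  have sp : 0 < sg k.
    rewrite lt_neqAle sg0 andbT eq_sym; apply/eqP => s0.
    have := SM k; rewrite -sgE s0 expr0n mulr0 => h1.
    by have := exprn_gt0 2 Sp; lra.
  have NSp : 0 < norm2 abs S by exact: (lt_le_trans Sp (abs_le_norm2 k Sell)).
  have l1 : ln (norm2 abs S / abs (S k)) <= ln (B / abs (S k)).
    rewrite ler_ln ?posrE ?divr_gt0// ler_pM2r ?invr_gt0//.
    apply: (le_trans SB); apply: ler_peMl; first by rewrite mulr_ge0// ltW.
    by have := expR_ge1Dx (1 : R); lra.
  have sL : sg k ^+ 2 * L k ^+ 2 <= \sum_(i < M) abs (p i k) ^+ 2.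
    rewrite sgE mulr_suml; apply: ler_sum => i _; rewrite absp// exprMn mulrC.
    rewrite ler_wpM2r ?sqr_ge0// sqr_le//.
    by have := Atau _ Ak; lra.
  have L1 : 1 <= L k by exact: lB.
  have FSle : abs (FS k) <= abs (P k) + sg k * L k.
    rewrite FSE absP// !mulrDl -addrA lerD2l.
    (* Where [|S k|] is at least [sg k], its logarithm is at most [L k]. Where it is smaller,
       monotonicity of [x ln (B / x)] gives the bound [sg k * L k], which the family [p]
       controls. *)
    have [sS|Ss] := leP (sg k) (abs (S k)).
      apply: (@le_trans _ _ (L k * abs (S k))).
        rewrite ler_pM2r//; apply: (le_trans l1).
        by rewrite ler_ln ?posrE ?divr_gt0// ler_pM2l// lef_pV2 ?posrE.
      by rewrite lerDl mulr_ge0.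
    apply: (@le_trans _ _ (sg k * L k)); last first.
      by rewrite lerDr mulr_ge0.
    apply: le_trans (xln_ratio_mono Sp (ltW Ss) L1).
    by rewrite mulrC ler_pM2l.
  have : abs (FS k) ^+ 2 <= (abs (P k) + sg k * L k) ^+ 2.
    by apply: sqr_le.
  have := sqr_ge0 (abs (P k) - sg k * L k).
  rewrite -exprMn in sL; nra.
(* The two halves contribute [8 M rho^2] each. Hence norm 4 for [FS] and 2 for [S], in units of
   [sqrt M * rho], and the constant 6. *)
have FSl2 : l2le FS (16 * (M%:R * rho ^+ 2)).
  move=> n; apply: (@le_trans _ _ (2 * \sum_(k < n) abs (P k) ^+ 2 +
      2 * \sum_(i < M) \sum_(k < n) abs (p i k) ^+ 2)).
    rewrite exchange_big /= !mulr_sumr -big_split; apply: ler_sum => k _.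
    exact: FSk.
  have h1 := Pl2 n.
  have h2 : \sum_(i < M) \sum_(k < n) abs (p i k) ^+ 2 <= M%:R * (4 * rho ^+ 2).
    rewrite mulr_natl -[in leRHS](card_ord M) -sumr_const; apply: ler_sum => i _.
    exact: pl2.
  lra.
have sM0 : 0 <= Num.sqrt M%:R * rho by rewrite mulr_ge0 ?sqrtr_ge0// ltW.
have sME : (Num.sqrt M%:R * rho) ^+ 2 = M%:R * rho ^+ 2.
  by rewrite exprMn sqr_sqrtr.
have NF : norm2 abs FS <= 4 * (Num.sqrt M%:R * rho).
  apply: norm2_le; first by rewrite mulr_ge0.
  by apply: l2leW FSl2; rewrite exprMn sME; lra.
have NS : norm2 abs S <= 2 * (Num.sqrt M%:R * rho).
  apply: norm2_le; first by rewrite mulr_ge0.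
  by apply: l2leW Sl2; rewrite exprMn sME; lra.
rewrite /Z2_qnorm /=; rewrite -/FS; have := lerD NF NS; lra.
Qed.

(** * Vectors supported in windows, and quasinorm estimates for them *)

Lemma unit_kernel_vector d (L : nat -> nat -> K) : exists c : nat -> K,
  \sum_(j < d.+1) abs (c j) ^+ 2 = 1 /\
  forall k, (k < d)%N -> \sum_(j < d.+1) c j * L j k = 0.
Proof.
pose A := \matrix_(j < d.+1, k < d) L j k.
(* There are [d + 1] unknowns against [d] equations. *)
have : kermx A != 0.
  by rewrite -mxrank_eq0 mxrank_ker -lt0n subn_gt0 ltnS rank_leq_col.
move=> /rowV0Pn[w /sub_kermxP wA w0].
pose S := \sum_(j < d.+1) abs (w 0 j) ^+ 2.
have S0 : 0 < S.
  rewrite lt_neqAle eq_sym sumr_ge0 ?andbT//; last by move=> j _; exact: sqr_ge0.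
  apply: contra w0; rewrite psumr_eq0; last by move=> j _; exact: sqr_ge0.
  move=> /allP h; apply/eqP/rowP => j; rewrite mxE.
  by have := h j (mem_index_enum _); rewrite /= sqrf_eq0 abs_eq0 => /eqP.
exists (fun j => emb (Num.sqrt S)^-1 * w 0 (inord j)); split=> [|k kd].
  under eq_bigr do rewrite inord_val absM absemb exprMn.
  rewrite -mulr_sumr -/S real_normK ?num_real// exprVn sqr_sqrtr ?ltW//.
  by rewrite mulVf// gt_eqF.
under eq_bigr do rewrite inord_val -mulrA.
rewrite -mulr_sumr; have /rowP/(_ (Ordinal kd)) := wA; rewrite !mxE.
by under eq_bigr do rewrite mxE; move=> ->; rewrite mulr0.
Qed.

Lemma sum_pick (c : nat -> K) (a m k : nat) :
  \sum_(j < m) c j * (if k == (a + j)%N then 1 else 0) =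
  if (a <= k < a + m)%N then c (k - a)%N else 0.
Proof.
elim: m => [|m IH]; first by rewrite big_ord0 addn0 ltnNge andbN.
rewrite big_ord_recr /= IH; have [->|km] := eqVneq k (a + m)%N.
  by rewrite ltnn andbF add0r leq_addr addnS leqnn /= addKn mulr1.
by rewrite mulr0 addr0 addnS ltnS [(k <= _)%N]leq_eqVlt (negbTE km).
Qed.

Definition window (a m : nat) (c : nat -> K) k : K :=
  if (a <= k < a + m)%N then c (k - a)%N else 0.

Lemma window_ge (a m : nat) c k : (a + m <= k)%N -> window a m c k = 0.
Proof. by move=> amk; rewrite /window (ltnNge k) amk andbF. Qed.

Lemma sum_window (V : nmodType) (F : nat -> V) (a m : nat) :
  (forall k, (k < a)%N -> F k = 0) ->
  \sum_(k < a + m) F k = \sum_(j < m) F (a + j)%N.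
Proof. by move=> Fa; rewrite big_split_ord /= big1 ?add0r// => k _; rewrite Fa. Qed.

Lemma norm2_window (a m : nat) (c : nat -> K) : \sum_(j < m) abs (c j) ^+ 2 = 1 ->
  norm2 abs (window a m c) = 1.
Proof.
move=> c1; apply/eqP; rewrite -(@eqrXn2 _ 2)// ?norm2_ge0// expr1n.
rewrite (norm2_fin (a + m)); last exact: window_ge.
rewrite (sum_window _ (fun k => abs (window a m c k) ^+ 2)).
  apply/eqP; rewrite -c1; apply: eq_bigr => j _.
  by rewrite /window leq_addr ltn_add2l ltn_ord addKn.
by move=> k ka; rewrite /window leqNgt ka abs0 expr0n.
Qed.

(** Coordinates of [g] have modulus at most 1, so those of [f - Omega g] are at most [(d + 1) + 1];
    there are [d + 1] of them, and [g] itself contributes 1. *)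
Lemma qnorm_window_le d (a : nat) (c : nat -> K) :
  \sum_(j < d.+1) abs (c j) ^+ 2 = 1 ->
  Z2_qnorm abs emb (fun k => - emb d.+1%:R * window a d.+1 c k, window a d.+1 c)
    <= (block_radius d)%:R.
Proof.
move=> c1; set g := window a d.+1 c; have g1 : norm2 abs g = 1 by exact: norm2_window.
have gl : ell2 abs g by apply: l2le_ell2; apply: (l2le_fin (a + d.+1)); exact: window_ge.
rewrite /Z2_qnorm /= g1 /block_radius -[(_ * _).+1%:R]natr1 lerD2r.
set F := fun k => _; pose t : R := d.+1%:R.
have FE k : abs (F k) = (t + ln (1 / abs (g k))) * abs (g k).
  by rewrite -g1; apply: abs_sub_Omega.
have Fle k : abs (F k) <= d.+2%:R.
  rewrite FE mulrDl -[d.+2%:R]natr1; have gk1 : abs (g k) <= 1.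
    by rewrite -g1; exact: abs_le_norm2.
  apply: lerD; first by rewrite ler_piMr.
  by rewrite mulrC xln_ratio_le1.
have F0 k : g k = 0 -> F k = 0.
  by move=> gk; apply/eqP; rewrite -abs_eq0 FE gk abs0 mulr0.
apply: norm2_le => //; apply: (@l2leW _ (\sum_(k < a + d.+1) abs (F k) ^+ 2)).
  rewrite (sum_window _ (fun k => abs (F k) ^+ 2)); last first.
    by move=> k ka; rewrite F0 ?abs0 ?expr0n// /g /window leqNgt ka.
  apply: (@le_trans _ _ (\sum_(j < d.+1) (d.+2%:R) ^+ 2)).
    by apply: ler_sum => j _; apply: sqr_le.
  rewrite sumr_const card_ord -[_ *+ d.+1]mulr_natr natrM exprMn ler_wpM2l ?sqr_ge0//.
  by rewrite expr2 ler_peMr// ler1n.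
by apply: l2le_fin => k ak; apply: F0; exact: window_ge.
Qed.

(** Disjointness gives [||S|| = sqrt M] and [|S k| <= 1] whatever the signs. The logarithm in
    [Omega] is therefore at least [ln (sqrt M) = ln M / 2] wherever [S] is nonzero. *)
Lemma qnorm_disjoint_sum_ge (t : R) (g : nat -> nat -> K) (e : nat -> bool) M N :
  0 <= t -> (forall i, (i < M)%N -> norm2 abs (g i) = 1) ->
  (forall i k, (i < M)%N -> (N <= k)%N -> g i k = 0) ->
  (forall i j k, (i < M)%N -> (j < M)%N -> g i k != 0 -> g j k != 0 -> i = j) ->
  Num.sqrt M%:R * (ln M%:R / 2) <= Z2_qnorm abs emb
    (fun k => - emb t * \sum_(i < M) (-1) ^+ e i * g i k,
     fun k => \sum_(i < M) (-1) ^+ e i * g i k).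
Proof.
move=> t0 g1 gN gdisj; set S := fun k => \sum_(i < M) (-1) ^+ e i * g i k.
have gl i : (i < M)%N -> ell2 abs (g i).
  by move=> iM; apply: l2le_ell2; apply: (l2le_fin N) => k; exact: gN.
have SE k : abs (S k) ^+ 2 = \sum_(i < M) abs (g i k) ^+ 2.
  have [[i gik]|/forallNP gk0] := pselect (exists i : 'I_M, g i k != 0).
    have gj (j : 'I_M) : j != i -> g j k = 0.
      move=> ji; apply/eqP; apply: contraNT ji => gjk.
      by apply/eqP/val_inj; apply: gdisj gjk gik.
    rewrite /S (bigD1 i)//= big1; last by move=> j /gj ->; rewrite mulr0.
    rewrite addr0 abs_sign (bigD1 i)//= big1 ?addr0// => j /gj ->.
    by rewrite abs0 expr0n.
  have gj (j : 'I_M) : g j k = 0 by apply/eqP; have /negP := gk0 j; rewrite negbK.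
  rewrite /S !big1 ?abs0 ?expr0n// => i _; rewrite gj ?mulr0//.
  by rewrite abs0 expr0n.
have SN k : (N <= k)%N -> S k = 0.
  by move=> Nk; apply: big1 => i _; rewrite gN ?mulr0.
have S2 : norm2 abs S ^+ 2 = M%:R.
  rewrite (norm2_fin N)//; under eq_bigr do rewrite SE.
  rewrite exchange_big /= -[in RHS](card_ord M) -sumr_const.
  by apply: eq_bigr => i _; rewrite -norm2_fin ?g1 ?expr1n// => k; exact: gN.
have S1 k : abs (S k) <= 1.
  apply: le_of_sqr => //; rewrite SE expr1n.
  have [[i gik]|/forallNP gk0] := pselect (exists i : 'I_M, g i k != 0).
    rewrite (bigD1 i)//= big1 ?addr0.
      rewrite -[leRHS](expr1n _ 2); apply: sqr_le => //.
      by rewrite -(g1 i)//; apply: abs_le_norm2; exact: gl.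
    move=> j ji; rewrite (_ : g j k = 0) ?abs0 ?expr0n//; apply/eqP.
    by apply: contraNT ji => gjk; apply/eqP/val_inj; apply: gdisj gjk gik.
  rewrite big1// => j _; have /negP := gk0 j; rewrite negbK => /eqP ->.
  by rewrite abs0 expr0n.
have Sl : ell2 abs S by apply: l2le_ell2; apply: (l2le_fin N).
have [->|M0] := posnP M.
  by rewrite sqrtr0 mul0r addr_ge0// norm2_ge0.
have M1 : 1 <= M%:R :> R by rewrite ler1n.
have NS : norm2 abs S = Num.sqrt M%:R by rewrite -S2 sqrtr_sqr ger0_norm ?norm2_ge0.
have sM0 : 0 < Num.sqrt M%:R :> R by rewrite sqrtr_gt0 ltr0n.
have lnM : ln (Num.sqrt M%:R) = ln M%:R / 2 :> R.
  have : ln (Num.sqrt M%:R ^+ 2) = ln M%:R :> R by rewrite sqr_sqrtr.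
  rewrite expr2 lnM ?posrE//; lra.
have lnM0 : 0 <= ln M%:R / 2 :> R by rewrite divr_ge0// ln_ge0.
rewrite /Z2_qnorm /=; set F := fun k => _.
have FE k : abs (F k) = (t + ln (norm2 abs S / abs (S k))) * abs (S k).
  exact: abs_sub_Omega.
have SF k : ln M%:R / 2 * abs (S k) <= abs (F k).
  have [Sk|Sk] := eqVneq (S k) 0; first by rewrite FE Sk abs0 !mulr0.
  have Sp : 0 < abs (S k) by rewrite abs_gt0.
  rewrite FE ler_pM2r// -lnM NS; apply: ler_wpDl => //.
  rewrite ler_ln ?posrE ?divr_gt0// ler_pdivlMr// ler_piMr//; exact: ltW.
have Fl : ell2 abs F.
  apply: l2le_ell2; apply: (l2le_fin N) => k /SN Sk.
  by apply/eqP; rewrite -abs_eq0 FE Sk abs0 mulr0.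
suff : Num.sqrt M%:R * (ln M%:R / 2) <= norm2 abs F.
  by move/le_trans; apply; rewrite lerDl norm2_ge0.
apply: le_of_sqr; first exact: norm2_ge0.
apply: le_trans (l2le_norm2 Fl N).
rewrite exprMn sqr_sqrtr// -[X in X * _]S2 (norm2_fin N)// mulr_suml.
apply: ler_sum => k _; rewrite -exprMn [abs (S k) * _]mulrC; apply: sqr_le; last exact: SF.
by rewrite mulr_ge0.
Qed.

(** * Coordinates on a Banach model of [Z2] *)

Section Space.
Variables (X : completeNormedModType K).
Variable T : {linear X -> ((nat -> K^o) * (nat -> K^o))%type}.
Hypothesis TZ2 : is_Banach_Z2 abs emb T.

Lemma T1P a (x y : X) k : (T (a *: x + y)).1 k = a * (T x).1 k + (T y).1 k.
Proof. by rewrite linearP. Qed.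

Lemma T2P a (x y : X) k : (T (a *: x + y)).2 k = a * (T x).2 k + (T y).2 k.
Proof. by rewrite linearP. Qed.

Lemma T_inj (x y : X) : (forall k, (T x).1 k = (T y).1 k) ->
  (forall k, (T x).2 k = (T y).2 k) -> x = y.
Proof.
move=> h1 h2; case: TZ2 => Tinj _ _; apply: Tinj.
by rewrite [LHS]surjective_pairing [RHS]surjective_pairing; congr (_, _); apply/funext.
Qed.

Lemma T_eq (x : X) (f g : nat -> K) : (forall k, (T x).1 k = f k) ->
  (forall k, (T x).2 k = g k) -> T x = (f, g).
Proof.
by move=> xf xg; rewrite [LHS]surjective_pairing; congr (_, _); apply/funext.
Qed.

Definition Tinv (z : (nat -> K^o) * (nat -> K^o)) : X := xget 0 [set x | T x = z].

Lemma TinvK z : Z2 abs emb z -> T (Tinv z) = z.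
Proof.
case: TZ2 => _ <- _ [x _ xz]; rewrite /Tinv.
by case: xgetP => [y _ //|/(_ x)]; rewrite /= xz.
Qed.

Lemma Z2_fin (f g : nat -> K) N :
  (forall k, (N <= k)%N -> f k = 0 /\ g k = 0) -> Z2 abs emb (f, g).
Proof.
move=> h; have gl : ell2 abs g by apply: l2le_ell2; apply: (l2le_fin N) => k /h[].
split=> //=; apply: l2le_ell2; apply: (l2le_fin N) => k /h[fk gk].
by rewrite fk Omega0// subr0.
Qed.

Lemma T_Z2 (x : X) : Z2 abs emb (T x).
Proof. by case: TZ2 => _ <- _; exists x. Qed.

(** Although the first component need not lie in [ell2], its coordinates are bounded:
    [x ln (G / x) <= G - x] shows that each coordinate of [Omega g] is at most the norm of [g]. *)
Lemma abs_T_le k : exists2 C, 0 <= C &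
  forall x : X, abs ((T x).1 k) <= C * abs `|x| /\ abs ((T x).2 k) <= C * abs `|x|.
Proof.
case: TZ2 => _ _ [c [C [_ C0 cC]]]; exists (2 * C); first by rewrite mulr_ge0// ltW.
move=> x; have [fgl gl] : ell2 abs (fun k => (T x).1 k - Omega abs emb (T x).2 k)
    /\ ell2 abs (T x).2 by have [] := T_Z2 x.
have [_] := cC x; rewrite /Z2_qnorm.
have := abs_le_norm2 k fgl; have gk := abs_le_norm2 k gl.
set F := norm2 abs (fun _ => _); set G := norm2 _ _ in gk *.
have F0 : 0 <= F by exact: norm2_ge0.
have G0 : 0 <= G by exact: norm2_ge0.
have Cx0 : 0 <= C * abs `|x| by rewrite mulr_ge0// ltW.
move=> Fk FGC; split; last lra.
have Ok : abs (Omega abs emb (T x).2 k) <= G.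
  rewrite OmegaE// absM absemb ger0_norm ?ln_ratio_ge0//.
  have [g0|g0] := eqVneq ((T x).2 k) 0; first by rewrite g0 abs0 mul0r.
  have gp : 0 < abs ((T x).2 k) by rewrite abs_gt0.
  have Gp : 0 < G by exact: lt_le_trans gk.
  have := ln_leB1 (divr_gt0 Gp gp); rewrite -(ler_pM2l gp).
  rewrite (_ : abs ((T x).2 k) * (G / _ - 1) = G - abs ((T x).2 k)); first lra.
  by field; rewrite gt_eqF.
have := absD ((T x).1 k - Omega abs emb (T x).2 k) (Omega abs emb (T x).2 k).
rewrite subrK; lra.
Qed.

Lemma bounded_continuous (V : normedModType K) (phi : X -> V) (C : R) :
  (forall x y : X, phi (x - y) = phi x - phi y) ->
  (forall x : X, `|phi x| <= emb (C * abs `|x|)) -> continuous phi.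
Proof.
move=> phiB phiC x; apply/cvgrPdist_le => e e0.
have C1 : 0 < emb (`|C| + 1) by rewrite -(rmorph0 emb) ltr_emb ltr_wpDl.
near=> y; rewrite -phiB (le_trans (phiC _))//.
have : `|x - y| <= e / emb (`|C| + 1).
  by near: y; apply: cvgr_dist_le; [exact: cvg_id|rewrite divr_gt0].
rewrite ler_pdivlMr// => /(le_trans _); apply.
have e1 : `|x - y| = emb (abs `|x - y|) by rewrite embabs normr_id.
rewrite [leRHS](_ : _ = emb (abs `|x - y| * (`|C| + 1))); last first.
  by rewrite rmorphM -e1.
rewrite ler_emb mulrC.
rewrite ler_wpM2l//; have := ler_norm C; lra.
Unshelve. all: by end_near. Qed.

Lemma continuous_T1 k : continuous (fun x : X => (T x).1 k : K^o).
Proof.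
have [C C0 hC] := abs_T_le k; apply: (@bounded_continuous _ _ C) => x.
  by move=> y; rewrite addrC -scaleN1r T1P mulN1r addrC.
by rewrite -embabs ler_emb; case: (hC x).
Qed.

Lemma continuous_T2 k : continuous (fun x : X => (T x).2 k : K^o).
Proof.
have [C C0 hC] := abs_T_le k; apply: (@bounded_continuous _ _ C) => x.
  by move=> y; rewrite addrC -scaleN1r T2P mulN1r addrC.
by rewrite -embabs ler_emb; case: (hC x).
Qed.

(** * The closed subspaces [line_space s] *)

Definition tau k : R := (block_start (block k)).+1%:R.

Definition on_line (s : bool) k (p q : K) : Prop :=
  if s then p = - emb (tau k) * q else q = 0.

Definition fin_space (s : cantor_space) : set X :=
  [set x | (forall k, on_line (s (block k)) k ((T x).1 k) ((T x).2 k)) /\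
    exists N, forall k, (N <= k)%N -> (T x).1 k = 0 /\ (T x).2 k = 0].

Definition line_space (s : cantor_space) : set X := closure (fin_space s).

Lemma on_lineP s k (p q p' q' : K) c : on_line s k p q -> on_line s k p' q' ->
  on_line s k (c * p + p') (c * q + q').
Proof.
rewrite /on_line; case: s => -> ->; last by rewrite mulr0 addr0.
by rewrite mulrDr mulrCA.
Qed.

Lemma fin_spaceP s c (x y : X) :
  fin_space s x -> fin_space s y -> fin_space s (c *: x + y).
Proof.
move=> [xl [M xM]] [yl [N yN]]; split.
  by move=> k; rewrite T1P T2P; apply: on_lineP.
exists (maxn M N) => k; rewrite geq_max T1P T2P => /andP[/xM[-> ->] /yN[-> ->]].
by rewrite mulr0 addr0.
Qed.

Lemma line_spaceP s c (x y : X) :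
  line_space s x -> line_space s y -> line_space s (c *: x + y).
Proof.
move=> ax ay U /= nU.
have : continuous (fun z : X * X => c *: z.1 + z.2).
  move=> z; apply: cvgD; last exact: cvg_snd.
  by apply: cvgZr; exact: cvg_fst.
move=> /(_ (x, y) U nU)[[A B] /= [nA nB] AB].
have [x' [ax' Ax']] := ax _ nA; have [y' [ay' By']] := ay _ nB.
exists (c *: x' + y'); split; first exact: fin_spaceP.
exact: (AB (x', y')).
Qed.

Lemma closed_subspace_line_space s : closed_subspace (line_space s).
Proof.
split; [exact: closed_closure| |exact: line_spaceP].
apply: subset_closure; split=> [k|]; last by exists 0%N => k _; rewrite linear0.
by rewrite linear0 /on_line /=; case: ifP; rewrite ?mulr0.
Qed.

(** Each line condition is the vanishing of a continuous functional, so it survives the closure. *)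
Lemma line_space_on_line s (x : X) k : line_space s x ->
  on_line (s (block k)) k ((T x).1 k) ((T x).2 k).
Proof.
pose phi (x : X) : K^o := if s (block k) then (T x).1 k + emb (tau k) * (T x).2 k
                    else (T x).2 k.
have phi0 (y : X) : on_line (s (block k)) k ((T y).1 k) ((T y).2 k) <-> phi y = 0.
  rewrite /on_line /phi; case: ifP => _ //; rewrite mulNr; split=> [->|/eqP].
    by rewrite addNr.
  by rewrite addr_eq0 => /eqP.
have cphi : continuous phi.
  rewrite /phi; case: (s _) => y; last exact: continuous_T2.
  apply: cvgD; first exact: continuous_T1.
  by apply: cvgM; [exact: cvg_cst|exact: continuous_T2].
rewrite phi0; have : closed (phi @^-1` [set 0]).
  apply: preimage_closed => [y _|]; first exact: cphi.
  exact/accessible_closed_set1/hausdorff_accessible/norm_hausdorff.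
move=> cl sx; suff : closure (phi @^-1` [set 0]) x by rewrite -(closure_id _).1.
by apply: closureS sx => y [/(_ k)/phi0].
Qed.

(** * Isomorphisms produced by finitely many changes of [s] *)

Definition swap_coord (s t : cantor_space) k (x : X) : K :=
  if s (block k) == t (block k) then 0
  else if s (block k) then (T x).2 k else (T x).1 k.

(** The shift exchanges the generators [(- tau k, 1)] and [(1, 0)] of the two lines: their
    difference is [(tau k + 1, - 1)] up to sign. *)
Definition line_shift (b : bool) k : K :=
  if b then emb (tau k) + 1 else - (emb (tau k) + 1).

Definition swap_vec (b : bool) k : X :=
  Tinv (fun j => if j == k then line_shift b k else 0,
        fun j => if j == k then (if b then -1 else 1) else 0).

(* A finite-rank perturbation of the identity that carries, at the coordinates
   below [N], the lines prescribed by [s] to those prescribed by [t]. *)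
Fixpoint swap (s t : cantor_space) N (x : X) : X :=
  if N is k.+1 then
    swap_coord s t k x *: swap_vec (s (block k)) k + swap s t k x
  else x.

Lemma T_swap_vec (b : bool) k : T (swap_vec b k) =
  (fun j => if j == k then line_shift b k else 0,
   fun j => if j == k then (if b then -1 else 1) else 0).
Proof.
apply: TinvK; apply: (@Z2_fin _ _ k.+1) => j kj.
by rewrite (gtn_eqF kj).
Qed.

Lemma T1_swap s t N (x : X) j : (T (swap s t N x)).1 j =
  (T x).1 j + (if (j < N)%N then swap_coord s t j x * line_shift (s (block j)) j else 0).
Proof.
elim: N => [|N IH]; first by rewrite addr0.
rewrite /= T1P IH T_swap_vec /= [(j < N.+1)%N]ltnS [(j <= N)%N]leq_eqVlt addrCA.
congr (_ + _).
by have [->|_] := eqVneq j N; rewrite /= ?ltnn ?mulr0 ?add0r ?addr0.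
Qed.

Lemma T2_swap s t N (x : X) j : (T (swap s t N x)).2 j =
  (T x).2 j + (if (j < N)%N then
                 swap_coord s t j x * (if s (block j) then -1 else 1) else 0).
Proof.
elim: N => [|N IH]; first by rewrite addr0.
rewrite /= T2P IH T_swap_vec /= [(j < N.+1)%N]ltnS [(j <= N)%N]leq_eqVlt addrCA.
congr (_ + _).
by have [->|_] := eqVneq j N; rewrite /= ?ltnn ?mulr0 ?add0r ?addr0.
Qed.

Lemma swapP s t N c (x y : X) : swap s t N (c *: x + y) =
  c *: swap s t N x + swap s t N y.
Proof.
elim: N => //= N ->.
have -> : swap_coord s t N (c *: x + y) = c * swap_coord s t N x + swap_coord s t N y.
  rewrite /swap_coord T1P T2P; case: eqP => _; first by rewrite mulr0 addr0.
  by case: ifP.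
by rewrite scalerDl scalerDr -scalerA addrACA.
Qed.

Lemma continuous_swap s t N : continuous (swap s t N).
Proof.
elim: N => [|N IH] x /=; first exact: cvg_id.
apply: cvgD; last exact: IH.
apply: cvgZl; rewrite /swap_coord; case: eqP => _; first exact: cvg_cst.
by case: (s _); [exact: continuous_T2|exact: continuous_T1].
Qed.

Lemma swap_on_line s t N (x : X) j :
  (forall k, (N <= k)%N -> s (block k) = t (block k)) ->
  on_line (s (block j)) j ((T x).1 j) ((T x).2 j) ->
  on_line (t (block j)) j ((T (swap s t N x)).1 j) ((T (swap s t N x)).2 j).
Proof.
move=> st; rewrite T1_swap T2_swap; case: ltnP => [jN|/st <-]; last by rewrite !addr0.
rewrite /swap_coord /on_line /line_shift.
by case: (s _); case: (t _) => /= h; rewrite ?h; ring.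
Qed.

Lemma swapK s t N (x : X) : (forall j, on_line (s (block j)) j ((T x).1 j) ((T x).2 j)) ->
  swap t s N (swap s t N x) = x.
Proof.
move=> xs; apply: T_inj => j.
  rewrite T1_swap [swap_coord t _ _ _]/swap_coord T1_swap T2_swap /swap_coord /line_shift.
  case: ltnP => // _; rewrite ?addr0//; have := xs j; rewrite /on_line.
  by case: (s _); case: (t _) => /= h; rewrite ?h; ring.
rewrite T2_swap [swap_coord t _ _ _]/swap_coord T1_swap T2_swap /swap_coord /line_shift.
case: ltnP => // _; rewrite ?addr0//; have := xs j; rewrite /on_line.
by case: (s _); case: (t _) => /= h; rewrite ?h; ring.
Qed.

Lemma swap_line_space s t N (x : X) :
  (forall k, (N <= k)%N -> s (block k) = t (block k)) ->
  line_space s x -> line_space t (swap s t N x).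
Proof.
move=> st sx U nU; have [y [[yl [M yM]] Uy]] := sx _ (@continuous_swap s t N x U nU).
exists (swap s t N y); split=> //; split=> [k|]; first exact: swap_on_line.
exists (maxn M N) => k; rewrite geq_max T1_swap T2_swap => /andP[/yM[-> ->] Nk].
by rewrite ltnNge Nk addr0.
Qed.

Lemma E0_isomorphic s t : E0 s t -> isomorphic (line_space s) (line_space t).
Proof.
(* The threshold [N] counts blocks, whereas [swap] needs one counting coordinates. *)
move=> [N _ Nst]; pose B := block_start N.
have st k : (B <= k)%N -> s (block k) = t (block k).
  by rewrite leqNgt -ltn_block -leqNgt => /Nst.
have ts k : (B <= k)%N -> t (block k) = s (block k) by move=> /st.
exists (swap s t B), (swap t s B); split.
- by move=> c x y _ _; exact: swapP.
- move=> x sx; split; first exact: swap_line_space.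
  by apply: swapK => j; exact: line_space_on_line.
- move=> x sx; split; first exact: swap_line_space.
  by apply: swapK => j; exact: line_space_on_line.
- exact/continuous_subspaceT/continuous_swap.
- exact/continuous_subspaceT/continuous_swap.
Qed.

(** * Borel dependence of [line_space s] on [s] *)

Lemma near_prefix (s : cantor_space) N :
  \forall t \near s, forall m, (m < N)%N -> t m = s m.
Proof.
elim: N => [|N IH]; first by near=> t.
have h : \forall t \near s, t N = s N.
  exact: (@proj_continuous nat (fun=> bool) N s _ (discrete_set1 (s N))).
near=> t => m; rewrite ltnS leq_eqVlt => /predU1P[->|mN].
  by near: t.
by move: m mN; near: t.
Unshelve. all: by end_near. Qed.

(** By density, meeting [U] is witnessed by a finitely supported vector, which belongs to
    [line_space t] for every [t] sharing a long enough prefix with [s]. *)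
Lemma open_line_space_meets (U : set X) : open U ->
  open [set s | line_space s `&` U !=set0].
Proof.
move=> oU; rewrite openE => s [x [sx Ux]].
have [y [[yl [N yN]] Uy]] := sx U (open_nbhs_nbhs (conj oU Ux)).
apply: filterS (near_prefix s N) => t ts; exists y; split=> //.
apply: subset_closure; split; last by exists N.
move=> k; have [Nk|kN] := leqP N k.
  by have [-> ->] := yN _ Nk; rewrite /on_line mulr0; case: ifP.
rewrite ts// ltn_block; apply: (leq_trans _ (block_start_mono _ _ (leqnn _))).
exact: leq_trans kN (leq_block_start N).
Qed.

Lemma Effros_line_space B : @Effros K X B ->
  <<s (open : set (set cantor_space)) >> (line_space @^-1` B).
Proof.
(* The generated sigma-algebra is the least one, so it suffices that the sets with Borel preimage
   form a sigma-algebra containing the generators. *)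
move=> /(_ (fun C => <<s open >> (line_space @^-1` C))); apply; split; first split.
- by rewrite preimage_set0; exact: sigma_algebra0.
- move=> A sA; rewrite (_ : _ @^-1` _ = ~` (line_space @^-1` A)).
    exact: sigma_algebraC.
  apply/seteqP; split=> s /=; first by case.
  by split=> //; exact: closed_subspace_line_space.
- by move=> A sA; rewrite preimage_bigcup; exact: sigma_algebra_bigcup.
move=> _ [U oU <-]; apply: sub_sigma_algebra.
rewrite (_ : _ @^-1` _ = [set s | line_space s `&` U !=set0]).
  exact: open_line_space_meets.
apply/seteqP; split=> s /=; first by case.
by split=> //; exact: closed_subspace_line_space.
Qed.

(** * Linear maps between closed subspaces *)

Lemma subspace_linear0 (F : set X) (u : X -> X) : F 0 ->
  (forall a (x y : X), F x -> F y -> u (a *: x + y) = a *: u x + u y) -> u 0 = 0.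
Proof.
move=> F0 uP; have := uP 1 0 0 F0 F0.
by rewrite !scale1r addr0 => /eqP; rewrite -[X in X == _]addr0 => /eqP/addrI <-.
Qed.

Lemma subspace_linear_sum (F : set X) (u : X -> X) (e : nat -> X) (c : nat -> K) m :
  closed_subspace F ->
  (forall a (x y : X), F x -> F y -> u (a *: x + y) = a *: u x + u y) ->
  (forall j, (j < m)%N -> F (e j)) ->
  F (\sum_(j < m) c j *: e j) /\
  u (\sum_(j < m) c j *: e j) = \sum_(j < m) c j *: u (e j).
Proof.
move=> [_ F0 FP] uP; elim: m => [|m IH] eF.
  by rewrite !big_ord0 (subspace_linear0 _ _ F0 uP).
have [j jm|Fm um] := IH; first by apply: eF; rewrite ltnW.
rewrite !big_ord_recr /= ![_ + _ *: _]addrC; split; first by apply: FP => //; exact: eF.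
by rewrite uP ?um//; exact: eF.
Qed.

(** Continuity at 0 within [F], applied to [x] rescaled to norm [d / 2]; the rescaled vector stays
    in [F], the only place where [u] is known to be linear. *)
Lemma subspace_linear_bounded (F : set X) (u : X -> X) :
  closed_subspace F ->
  (forall a (x y : X), F x -> F y -> u (a *: x + y) = a *: u x + u y) ->
  {within F, continuous u} ->
  exists2 C : R, 0 < C & forall x : X, F x -> abs `|u x| <= C * abs `|x|.
Proof.
move=> FP uP; have [_ F0 FZ] := FP.
have u0 := subspace_linear0 _ _ F0 uP.
have uZ a (x : X) : F x -> u (a *: x) = a *: u x.
  by move=> Fx; have := uP a x 0 Fx F0; rewrite u0 !addr0.
move=> /subspace_continuousP/(_ 0 F0) cu0.
have : u x @[x --> within F (nbhs (0 : X))] --> (0 : X) by rewrite -[X in _ --> X]u0.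
move=> /cvgr0Pnorm_lt/(_ 1 ltr01).
rewrite near_withinE => /nbhs_norm0P[d /= d0 dP].
have d20 : 0 < d / 2 by rewrite divr_gt0.
have absd : emb (abs (d / 2)) = d / 2 by rewrite embabs gtr0_norm.
have ad : 0 < abs (d / 2) by rewrite abs_gt0 gt_eqF.
exists (abs (d / 2))^-1; first by rewrite invr_gt0.
move=> x Fx; have [->|x0] := eqVneq x 0.
  by rewrite u0 normr0 abs0 mulr0.
have nx : 0 < `|x| by rewrite normr_gt0.
have Fy : F ((d / 2 / `|x|) *: x) by rewrite -[X in F X]addr0; exact: FZ.
have ny : `|(d / 2 / `|x|) *: x| = d / 2.
  by rewrite normrZ normrM normfV normr_id -mulrA mulVf ?gt_eqF// mulr1 gtr0_norm.
have /= := dP ((d / 2 / `|x|) *: x); rewrite ny => /(_ _ Fy).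
rewrite ltr_pdivrMr// ltr_pMr// ltr1n => /(_ isT).
rewrite uZ// normrZ normrM normfV normr_id (gtr0_norm d20) -mulrA => h.
rewrite -ler_emb rmorphM fmorphV absd !embabs !normr_id.
rewrite mulrC ler_pdivlMr// mulrC.
by move: h; rewrite -(ltr_pM2l nx) mulr1 mulrCA mulVKf ?gt_eqF// => /ltW.
Qed.

Lemma subspace_linear_qnorm (F : set X) (u : X -> X) :
  closed_subspace F ->
  (forall a (x y : X), F x -> F y -> u (a *: x + y) = a *: u x + u y) ->
  {within F, continuous u} ->
  exists2 C : R, 0 < C & forall x : X, F x ->
    Z2_qnorm abs emb (T (u x)) <= C * Z2_qnorm abs emb (T x).
Proof.
move=> FP uP /(subspace_linear_bounded _ _ FP uP)[B B0 uB].
case: TZ2 => _ _ [c [C [c0 C0 cC]]]; exists (C * (B / c)).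
  by rewrite mulr_gt0// divr_gt0.
move=> x Fx; have [_ h1] := cC (u x); have [h2 _] := cC x.
apply: (le_trans h1); rewrite -mulrA ler_pM2l//; apply: (le_trans (uB _ Fx)).
by rewrite -mulrA ler_pM2l// ler_pdivlMl.
Qed.

Lemma inverse_linear (F G : set X) (u v : X -> X) : closed_subspace F ->
  (forall a (x y : X), F x -> F y -> u (a *: x + y) = a *: u x + u y) ->
  (forall x : X, F x -> G (u x) /\ v (u x) = x) ->
  (forall y : X, G y -> F (v y) /\ u (v y) = y) ->
  forall a (x y : X), G x -> G y -> v (a *: x + y) = a *: v x + v y.
Proof.
move=> [_ _ FP] uP uv vu a x y Gx Gy.
have [Fx ux] := vu _ Gx; have [Fy uy] := vu _ Gy.
by rewrite -{1}ux -{1}uy -uP// (uv _ (FP _ _ _ Fx Fy)).2.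
Qed.

Lemma isomorphic_sym (F G : set X) : closed_subspace F ->
  isomorphic F G -> isomorphic G F.
Proof.
move=> FP [u [v [uP uv vu cu cv]]]; exists v, u; split=> //.
exact: inverse_linear uP uv vu.
Qed.

(** * Obstruction to isomorphism *)

Lemma T1_sum (c : nat -> K) (e : nat -> X) m k :
  (T (\sum_(j < m) c j *: e j)).1 k = \sum_(j < m) c j * (T (e j)).1 k.
Proof.
elim: m => [|m IH]; first by rewrite !big_ord0 linear0.
by rewrite !big_ord_recr /= addrC T1P IH addrC.
Qed.

Lemma T2_sum (c : nat -> K) (e : nat -> X) m k :
  (T (\sum_(j < m) c j *: e j)).2 k = \sum_(j < m) c j * (T (e j)).2 k.
Proof.
elim: m => [|m IH]; first by rewrite !big_ord0 linear0.
by rewrite !big_ord_recr /= addrC T2P IH addrC.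
Qed.

Definition coord_vec k : X :=
  Tinv (fun j => - emb (tau k) * (if j == k then 1 else 0),
        fun j => if j == k then 1 else 0).

Lemma T_coord_vec k : T (coord_vec k) =
  (fun j => - emb (tau k) * (if j == k then 1 else 0),
   fun j => if j == k then 1 else 0).
Proof.
apply: TinvK; apply: (@Z2_fin _ _ k.+1) => j kj.
by rewrite (gtn_eqF kj) mulr0.
Qed.

Lemma line_space_coord_vec (s : cantor_space) k :
  s (block k) -> line_space s (coord_vec k).
Proof.
move=> sk; apply: subset_closure; rewrite /fin_space /= T_coord_vec; split=> [j|] /=.
  have [->|_] := eqVneq j k; first by rewrite sk.
  by rewrite /on_line !mulr0; case: ifP.
by exists k.+1 => j kj; rewrite (gtn_eqF kj) mulr0.
Qed.

(* Each of the [group_count n _] groups of [d + 1] coordinates of the [n]-th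
   block carries a unit vector whose image under [u] vanishes at all [d]
   coordinates preceding that block, by counting dimensions. *)
Lemma group_vector (n i : nat) (s t : cantor_space) (u : X -> X) :
  let d := block_start n in
  s n -> (i < group_count n d)%N ->
  (forall a (x y : X), line_space s x -> line_space s y ->
     u (a *: x + y) = a *: u x + u y) ->
  (forall x : X, line_space s x -> line_space t (u x)) ->
  exists (c : nat -> K) (x : X),
    [/\ \sum_(j < d.+1) abs (c j) ^+ 2 = 1, line_space s x,
        forall k, (T x).2 k = window (d + i * d.+1) d.+1 c k,
        forall k, (T x).1 k = - emb d.+1%:R * (T x).2 k &
        forall k, (k < d)%N -> (T (u x)).1 k = 0 /\ (T (u x)).2 k = 0].
Proof.
move=> d sn iM uP ust; set a := (d + i * d.+1)%N.
have blka j : (j < d.+1)%N -> block (a + j) = n.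
  move=> jd; apply: block_eq; rewrite -/d /a -addnA leq_addr /= -/d ltn_add2l.
  apply: (@leq_trans (i.+1 * d.+1)); first by rewrite mulSn addnC ltn_add2r.
  by rewrite leq_mul2r iM orbT.
pose e j := coord_vec (a + j).
have es j : (j < d.+1)%N -> line_space s (e j).
  by move=> jd; apply: line_space_coord_vec; rewrite blka.
(* In [line_space t] a single scalar determines both components at coordinate [k], so killing the
   first [d] coordinates costs [d] equations rather than [2 d]. *)
pose L j k := if t (block k) then (T (u (e j))).2 k else (T (u (e j))).1 k.
have [c [c1 cL]] := unit_kernel_vector d L.
have [xs ux] := subspace_linear_sum _ _ e c _ (closed_subspace_line_space s) uP es.
set x := \sum_(j < _) _ in xs ux; exists c, x.
have x2 k : (T x).2 k = window a d.+1 c k.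
  by rewrite /window -sum_pick T2_sum; apply: eq_bigr => j _; rewrite T_coord_vec.
split=> // k.
  rewrite T1_sum T2_sum mulr_sumr; apply: eq_bigr => j _; rewrite T_coord_vec /=.
  by rewrite mulrCA /tau blka.
move=> kd; have := cL k kd; rewrite /L.
have := line_space_on_line t (u x) k (ust _ xs); rewrite /on_line ux.
rewrite (T1_sum c (fun j => u (e j))) (T2_sum c (fun j => u (e j))).
case: (t _) => /= h h0; first by rewrite h h0 mulr0.
by rewrite h h0.
Qed.

(** For the signed sum [w], the two estimates give [sqrt M * ln M / 2 <= Q(w) <= C Q(u w) <= 6 C^2 r
    sqrt M], where [Q] is the quasinorm. Since [ln M >= n r], both [M] and [r] cancel. *)
Lemma not_isomorphic_bound n (s t : cantor_space) (u : X -> X) (C : R) :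
  0 < C -> s n -> ~~ t n ->
  (forall a (x y : X), line_space s x -> line_space s y ->
     u (a *: x + y) = a *: u x + u y) ->
  (forall x : X, line_space s x -> line_space t (u x)) ->
  (forall x : X, line_space s x ->
     Z2_qnorm abs emb (T (u x)) <= C * Z2_qnorm abs emb (T x)) ->
  (forall x : X, line_space s x ->
     Z2_qnorm abs emb (T x) <= C * Z2_qnorm abs emb (T (u x))) ->
  n%:R <= 12 * C ^+ 2.
Proof.
move=> C0 sn tn uP ust uC Cu.
pose d := block_start n; pose M := group_count n d; pose r := block_radius d.
pose good i (z : (nat -> K) * X) :=
    [/\ \sum_(j < d.+1) abs (z.1 j) ^+ 2 = 1, line_space s z.2,
        forall k, (T z.2).2 k = window (d + i * d.+1) d.+1 z.1 k,
        forall k, (T z.2).1 k = - emb d.+1%:R * (T z.2).2 k &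
        forall k, (k < d)%N -> (T (u z.2)).1 k = 0 /\ (T (u z.2)).2 k = 0].
have /choice[z zP] : forall i, exists z, (i < M)%N -> good i z.
  move=> i; have [iM|iM] := ltnP i M; last by exists (fun=> 0, 0).
  by have [c [x h]] := group_vector _ _ _ _ _ sn iM uP ust; exists (c, x).
pose x i := (z i).2; pose g i := (T (x i)).2 : nat -> K.
have xs i : (i < M)%N -> line_space s (x i) by case/zP.
have gE i : (i < M)%N -> g i = window (d + i * d.+1) d.+1 (z i).1.
  by move=> iM; apply/funext => k; have [_ _ h _ _] := zP _ iM; exact: h.
have x1 i k : (i < M)%N -> (T (x i)).1 k = - emb d.+1%:R * g i k.
  by case/zP=> _ _ _ h _; exact: h.
have M0 : (0 < M)%N by exact: group_count_gt0.
have M1 : 1 <= M%:R :> R by rewrite ler1n.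
have r0 : 0 < r%:R :> R by rewrite ltr0n.
have Qx i : (i < M)%N -> Z2_qnorm abs emb (T (x i)) <= r%:R.
  move=> iM; have [c1 _ _ _ _] := zP _ iM.
  apply: le_trans (qnorm_window_le d (d + i * d.+1) _ c1).
  by rewrite -gE// (T_eq (x i) _ (g i) (fun k => x1 i k iM) (fun k => erefl)).
pose f i := (T (u (x i))).1 : nat -> K; pose h i := (T (u (x i))).2 : nat -> K.
(* As [t n] is false, these coordinates all lie in blocks after the [n]-th, where [tau] is at least
   [M >= 1 + ln M]. Elsewhere the second components of the images vanish. *)
pose A k := (d <= k)%N && t (block k).
have fh0 i k : (i < M)%N -> (k < d)%N -> f i k = 0 /\ h i k = 0.
  by case/zP=> _ _ _ _ h0; exact: h0.
have yl i k : (i < M)%N -> on_line (t (block k)) k (f i k) (h i k).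
  by move=> iM; apply: line_space_on_line; apply/ust/xs.
have lnMM : 1 + ln M%:R <= M%:R :> R.
  by have := @ln_leB1 R M%:R; rewrite ltr0n => /(_ M0); lra.
have Atau k : A k -> M%:R <= tau k.
  move=> /andP[dk tk]; rewrite /tau ler_nat ltnW// ltnS.
  apply: leq_trans (leq_trans (leq_addr _ _) (block_startS n)) _.
  apply: block_start_mono; rewrite ltn_neqAle leqNgt ltn_block -leqNgt dk andbT.
  by apply: contraNneq tn => ->.
have fA i k : (i < M)%N -> A k -> f i k = - emb (tau k) * h i k.
  by move=> iM /andP[dk tk]; have := yl i k iM; rewrite /on_line tk.
have hA i k : (i < M)%N -> ~~ A k -> h i k = 0.
  move=> iM; rewrite negb_and -ltnNge => /orP[kd|tk].
    by case: (fh0 i k iM kd).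
  by have := yl i k iM; rewrite /on_line (negbTE tk).
have yZ2 i : (i < M)%N -> Z2 abs emb (f i, h i).
  by move=> iM; rewrite /f /h -surjective_pairing; exact: T_Z2.
have Qy i : (i < M)%N -> Z2_qnorm abs emb (f i, h i) <= C * r%:R.
  move=> iM; rewrite /f /h -surjective_pairing; apply: (le_trans (uC _ (xs _ iM))).
  by rewrite ler_pM2l// Qx.
have [e Qe] := exists_signs_Z2 A tau f h M _ _ M0 (mulr_gt0 C0 r0) lnMM Atau fA hA yZ2 Qy.
have [ws uw] := subspace_linear_sum _ _ x (fun i => (-1) ^+ e i) _
  (closed_subspace_line_space s) uP xs.
set w := \sum_(i < _) _ in ws uw.
have Tuw : T (u w) = (fun k => \sum_(i < M) (-1) ^+ e i * f i k,
                      fun k => \sum_(i < M) (-1) ^+ e i * h i k).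
  apply: T_eq => k; rewrite uw.
    exact: (T1_sum (fun i => (-1) ^+ e i) (fun i => u (x i))).
  exact: (T2_sum (fun i => (-1) ^+ e i) (fun i => u (x i))).
have Qw : Z2_qnorm abs emb (T w) <= C * (6 * (Num.sqrt M%:R * (C * r%:R))).
  by apply: (le_trans (Cu _ ws)); rewrite ler_pM2l// Tuw.
have Qw' : Num.sqrt M%:R * (ln M%:R / 2) <= Z2_qnorm abs emb (T w).
  apply: (le_trans (@qnorm_disjoint_sum_ge d.+1%:R g e M (d + M * d.+1) _ _ _ _)) => //.
  - by move=> i iM; rewrite gE// norm2_window//; case: (zP _ iM).
  - move=> i k iM Nk; rewrite gE// window_ge//; apply: leq_trans Nk.
    by rewrite -addnA leq_add2l addnC -mulSn leq_mul2r iM orbT.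
  - move=> i j k iM jM; rewrite !gE// /window.
    case: ifP => [/andP[ik ki] _|_]; last by rewrite eqxx.
    case: ifP => [/andP[jk kj] _|_]; last by rewrite eqxx.
    by apply: (group_inj d.+1 i j (k - d)); lia.
  have w1 k : (T w).1 k = - emb d.+1%:R * \sum_(i < M) (-1) ^+ e i * g i k.
    by rewrite (T1_sum (fun i => (-1) ^+ e i) x) mulr_sumr; apply: eq_bigr => i _;
      rewrite x1// mulrCA.
  have w2 k : (T w).2 k = \sum_(i < M) (-1) ^+ e i * g i k.
    exact: (T2_sum (fun i => (-1) ^+ e i) x).
  by rewrite (T_eq _ _ _ w1 w2).
have sM0 : 0 < Num.sqrt M%:R :> R by rewrite sqrtr_gt0 ltr0n.
have lnM : n%:R * r%:R <= ln M%:R :> R.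
  have -> : ln M%:R = ln 4 * (n * r)%:R :> R.
    by rewrite /M /group_count natrX lnXn// mulr_natr.
  by rewrite -natrM ler_peMl// ln4_ge1.
have : ln M%:R / 2 <= 6 * C ^+ 2 * r%:R.
  rewrite -(ler_pM2l sM0); apply: (le_trans Qw'); apply: (le_trans Qw).
  by rewrite le_eqVlt; apply/predU1P; left; ring.
move=> h1; rewrite -(ler_pM2r r0); lra.
Qed.

(** The constants of the isomorphism do not depend on [n], so only finitely many [n] can satisfy
    [s n] without [t n]. *)
Lemma isomorphic_near_le (s t : cantor_space) :
  isomorphic (line_space s) (line_space t) -> \forall n \near \oo, s n -> t n.
Proof.
move=> [u [v [uP uv vu cu cv]]].
have Fs := closed_subspace_line_space s; have Ft := closed_subspace_line_space t.
have vP := inverse_linear _ _ _ _ Fs uP uv vu.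
have [C C0 uC] := subspace_linear_qnorm _ _ Fs uP cu.
have [D D0 vD] := subspace_linear_qnorm _ _ Ft vP cv.
have CD0 : 0 < C + D by rewrite addr_gt0.
have Q0 (x : X) : 0 <= Z2_qnorm abs emb (T x) by rewrite addr_ge0 ?norm2_ge0.
near=> n => sn; have [//|tn] := boolP (t n); exfalso.
(* [C + D] serves as a common constant for both directions. *)
have : n%:R <= 12 * (C + D) ^+ 2.
  apply: (not_isomorphic_bound n s t u _ CD0 sn tn uP) => [x /uv[]//|x sx|x sx].
    by apply: (le_trans (uC _ sx)); rewrite ler_wpM2r// lerDl ltW.
  have [tux {1}<-] := uv _ sx; apply: (le_trans (vD _ tux)).
  by rewrite ler_wpM2r// lerDr ltW.
apply/negP; rewrite -ltNge; near: n.
exact: nbhs_infty_gtr.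
Unshelve. all: by end_near. Qed.

Lemma ergodic_of_Banach_Z2 : ergodic X.
Proof.
exists line_space; split.
- exact: closed_subspace_line_space.
- exact: Effros_line_space.
move=> s t; split; first exact: E0_isomorphic.
move=> st; have ts := isomorphic_sym _ _ (closed_subspace_line_space s) st.
apply: filterS2 (isomorphic_near_le _ _ st) (isomorphic_near_le _ _ ts) => n h1 h2.
by apply/idP/idP.
Qed.

End Space.
End Scalars.
Theorem theorem1p8 (R : realType) :
  (forall (X : completeNormedModType R)
     (T : {linear X -> ((nat -> R^o) * (nat -> R^o))%type}),
     is_Banach_Z2 (@Num.norm R R) idfun T -> ergodic X) /\
  (forall (X : completeNormedModType R[i])
     (T : {linear X -> ((nat -> R[i]^o) * (nat -> R[i]^o))%type}),
     is_Banach_Z2 (@Normc.normc R) (real_complex R) T -> ergodic X).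
Proof.
split=> X T TZ2.
  apply: (ergodic_of_Banach_Z2 (@Num.norm R R) idfun _ _ _ _ X T TZ2) => //= a b.
  by rewrite !real_normK ?num_real//; ring.
(* Turns the parallelogram law into a polynomial identity in real and imaginary parts. *)
have normc2 (z : R[i]) : Normc.normc z ^+ 2 = complex.Re z ^+ 2 + complex.Im z ^+ 2.
  by case: z => x y /=; rewrite sqr_sqrtr// addr_ge0// sqr_ge0.
apply: (ergodic_of_Banach_Z2 (@Normc.normc R) (real_complex R) _ _ _ _ X T TZ2) => //=.
- by move=> r; rewrite expr0n addr0 sqrtr_sqr.
- by case=> x y; exact: sqrtr_ge0.
- by move=> [a1 a2] [b1 b2]; rewrite !normc2 /=; ring.
Qed.
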